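(* Let $(\mathfrak g,[\cdot,\cdot,\cdot]_{\mathfrak g},\omega)$ be a nonzero finite-dimensional symplectic $3$-Lie algebra over $\mathbb R$ or $\mathbb C$. Then there exists a paracomplex structure $E$ on the $3$-Lie algebra $\mathfrak g$ such that $(\mathfrak g,\omega,E)$ is a para-Kähler $3$-Lie algebra if and only if there exist two isotropic (with respect to $\omega$) $3$-Lie subalgebras $\mathfrak g_+$ and $\mathfrak g_-$ such that $\mathfrak g=\mathfrak g_+\oplus\mathfrak g_-$ as a direct sum of vector spaces.
   Context: A $3$-Lie algebra is a vector space $\mathfrak g$ with a trilinear skew-symmetric bracket $[\cdot,\cdot,\cdot]_{\mathfrak g}$ satisfying $[x,y,[z,w,v]]=[[x,y,z],w,v]+[z,[x,y,w],v]+[z,w,[x,y,v]]$. A symplectic structure on $\mathfrak g$ is a nondegenerate skew-symmetric bilinear form $\omega$ with $\omega([x,y,z],w)-\omega([y,z,w],x)+\omega([z,w,x],y)-\omega([w,x,y],z)=0$ for all $x,y,z,w\in\mathfrak g$. A subspace $V$ is isotropic if $\omega(V,V)=0$. A product structure on $\mathfrak g$ is a linear map $E:\mathfrak g\to\mathfrak g$ with $E^2=\mathrm{Id}$, $E\neq\pm\mathrm{Id}$, such that for all $x,y,z\in\mathfrak g$: $E[x,y,z]=[Ex,Ey,Ez]+[Ex,y,z]+[x,Ey,z]+[x,y,Ez]-E[Ex,Ey,z]-E[x,Ey,Ez]-E[Ex,y,Ez]$. A paracomplex structure is a product structure whose eigenspaces for the eigenvalues $+1$ and $-1$ have the same dimension.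 A para-Kähler $3$-Lie algebra is a triple $(\mathfrak g,\omega,E)$ with $\omega$ a symplectic structure and $E$ a paracomplex structure on $\mathfrak g$ such that $\omega(Ex,Ey)=-\omega(x,y)$ for all $x,y\in\mathfrak g$. *)

(* Defs.v *)
(* Mathematical Components, with MathComp-Analysis for the real numbers and
   mathcomp-real-closed for the complex numbers R[i]. *)
From HB Require Import structures.
From mathcomp Require Import all_boot all_order all_algebra.
From mathcomp Require Import complex reals.

Set Implicit Arguments.
Unset Strict Implicit.
Unset Printing Implicit Defensive.

Import GRing.Theory.
Local Open Scope ring_scope.

Inductive real_or_complex_field (R : realType) : fieldType -> Prop :=
  | RealField : real_or_complex_field R R
  | ComplexField : real_or_complex_field R R[i].

Section ThreeLie.
Variables (K : fieldType) (g : vectType K) (br : g -> g -> g -> g).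
Local Notation "[ x , y , z ]_g" := (br x y z) (format "[ x ,  y ,  z ]_g").

(* The two adjacent transpositions generate 'S_3, so skew12 and skew23 give
   skew-symmetry under all permutations of the arguments. *)
Record three_lie_bracket : Prop := ThreeLieBracket {
  three_lie_linear1 : forall y z, linear (fun x => [x, y, z]_g);
  three_lie_linear2 : forall x z, linear (fun y => [x, y, z]_g);
  three_lie_linear3 : forall x y, linear (fun z => [x, y, z]_g);
  three_lie_skew12 : forall x y z, [y, x, z]_g = - [x, y, z]_g;
  three_lie_skew23 : forall x y z, [x, z, y]_g = - [x, y, z]_g;
  three_lie_fundamental : forall x y z w v,
    [x, y, [z, w, v]_g]_g =
      [[x, y, z]_g, w, v]_g + [z, [x, y, w]_g, v]_g + [z, w, [x, y, v]_g]_g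
}.

Definition three_lie_subalgebra (V : {vspace g}) : Prop :=
  forall x y z, x \in V -> y \in V -> z \in V -> [x, y, z]_g \in V.

Record symplectic_structure (omega : {skew_symmetric g}) : Prop :=
  SymplecticStructure {
    symplectic_nondegenerate : nondegenerate omega;
    symplectic_closed : forall x y z w,
      omega [x, y, z]_g w - omega [y, z, w]_g x
        + omega [z, w, x]_g y - omega [w, x, y]_g z = 0
  }.

Definition isotropic (omega : {skew_symmetric g}) (V : {vspace g}) : Prop :=
  forall x y, x \in V -> y \in V -> omega x y = 0.

Record product_structure (E : 'End(g)) : Prop := ProductStructure {
  product_involutive : (E \o E)%VF = \1%VF;
  product_neq_id : E <> \1%VF;
  product_neq_opp_id : E <> - \1%VF;
  product_integrable : forall x y z,
    E [x, y, z]_g =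
      [E x, E y, E z]_g + [E x, y, z]_g + [x, E y, z]_g + [x, y, E z]_g
        - E [E x, E y, z]_g - E [x, E y, E z]_g - E [E x, y, E z]_g
}.

Record paracomplex_structure (E : 'End(g)) : Prop := ParacomplexStructure {
  paracomplex_product : product_structure E;
  paracomplex_dim :
    \dim (passmx.leigenspace E 1) = \dim (passmx.leigenspace E (-1))
}.

Record para_kahler (omega : {skew_symmetric g}) (E : 'End(g)) : Prop :=
  ParaKahler {
    para_kahler_three_lie : three_lie_bracket;
    para_kahler_symplectic : symplectic_structure omega;
    para_kahler_paracomplex : paracomplex_structure E;
    para_kahler_compat : forall x y, omega (E x) (E y) = - omega x y
  }.

End ThreeLie.

(* Main.v *)
Require Import Defs.
From HB Require Import structures.
From mathcomp Require Import all_boot all_order all_algebra.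
From mathcomp Require Import complex reals.
From mathcomp Require Import ring.

Set Implicit Arguments.
Unset Strict Implicit.
Unset Printing Implicit Defensive.

Import GRing.Theory.
Local Open Scope ring_scope.

(** An involution E of a vector space over a field where 2 is invertible is the
    same thing as a decomposition g = g+ (+) g- into its eigenspaces for 1 and
    -1, and the theorem holds because each condition on E translates into one on
    the eigenspaces.

    - Integrability of E means that both eigenspaces are subalgebras. On
      eigenvectors for a, b, c the right-hand side of the integrability condition
      is (abc + a + b + c) B - (ab + bc + ac) E B, where B is their bracket
      ([integrability_rhs_eigen]). If the signs a, b, c are not all equal, the
      coefficients are 0 and -1 and the condition is an identity; if they are all
      equal to a, it becomes 4 E B = 4 a B, which says that B stays in the
      eigenspace ([eigenspace_subalgebra], [integrable_of_subalgebras]).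

    - The compatibility omega (E x) (E y) = - omega x y says that both
      eigenspaces are isotropic: for x, y in the same eigenspace the left-hand
      side is omega x y ([isotropic_eigenspace]); conversely only the mixed terms
      of omega x y survive, and E reverses their sign
      ([reflection_anti_isometry]).

    - The eigenspaces have equal dimension as soon as they are isotropic: a
      nondegenerate omega then pairs g+ with g- without kernel on either side
      ([dim_isotropic_summands]). Since g is nonzero, neither is zero, which is
      what excludes E = 1 and E = -1. *)

(** * Dimensions of isotropic subspaces *)

Section Orthogonality.
Variables (F : fieldType) (eps : bool) (theta : {rmorphism F -> F}).
Variables (vT : vectType F) (form : {hermitian vT for eps & theta}).
Implicit Types U V W : {vspace vT}.

(** The map from [vT] to the dual of [W] induced by the form, with functionals
    on [W] written in the dual basis of [vbasis W]. *)
Definition pairing_row W (u : vT) : 'rV[F]_(\dim W) :=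
  \row_i form u (vbasis W)`_i.

Fact pairing_row_is_linear W : linear (pairing_row W).
Proof. by move=> a u v; apply/rowP => i; rewrite !mxE linearPl. Qed.

HB.instance Definition _ W :=
  GRing.isLinear.Build F vT 'rV[F]_(\dim W) *:%R (pairing_row W)
    (pairing_row_is_linear W).

(** The hypothesis makes the map from [U] to the dual of [W] injective. *)
Lemma dimv_le_pairing U W : (U :&: orthov form W = 0)%VS ->
  (\dim U <= \dim W)%N.
Proof.
move=> UW0; rewrite -(limg_ker_dim (linfun (pairing_row W)) U).
suff -> : (U :&: lker (linfun (pairing_row W)) = 0)%VS.
  rewrite dimv0; apply: leq_trans (dimvS (subvf _)) _.
  by rewrite dimvf /dim /= mul1n.
apply/eqP; rewrite -subv0 -UW0; apply: capvS => //; apply/subvP => u.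
rewrite memv_ker lfunE => /eqP/rowP u_row; apply/mem_orthovP => w.
move=> /coord_vbasis ->; rewrite linear_sumr big1 // => i _.
have := u_row i; rewrite !mxE => u_i.
by rewrite linearZr_LR /= u_i mulr0.
Qed.

(** A vector of [U] orthogonal to [W] is also orthogonal to [U], hence lies in
    the radical. *)
Lemma isotropic_pairing U W : nondegenerate form ->
  {in U &, forall u v, form u v = 0} -> (U + W = fullv)%VS ->
  (U :&: orthov form W = 0)%VS.
Proof.
move=> /eqP nondeg Uiso UWfull; apply/eqP; rewrite -subv0 -nondeg.
apply/subvP => u /memv_capP[uU /mem_orthovP uW]; apply/mem_orthovP => v _.
have /memv_addP[v1 v1U [v2 v2W ->]] : v \in (U + W)%VS by rewrite UWfull memvf.
by rewrite linearDr /= Uiso // uW // addr0.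
Qed.

Lemma dim_isotropic_summands U W : nondegenerate form ->
  {in U &, forall u v, form u v = 0} -> {in W &, forall u v, form u v = 0} ->
  (U + W = fullv)%VS -> \dim U = \dim W.
Proof.
move=> nondeg Uiso Wiso UW; apply/eqP; rewrite eqn_leq.
rewrite (dimv_le_pairing (isotropic_pairing nondeg Uiso UW)) /=.
by apply/dimv_le_pairing/isotropic_pairing => //; rewrite addvC.
Qed.

End Orthogonality.

(** * Involutions and direct sum decompositions *)

Section Involutions.
Variables (K : fieldType) (V : vectType K).
Implicit Types (E : 'End(V)) (U W : {vspace V}).

Local Notation eigenspace := passmx.leigenspace.

Lemma mem_eigenspace E a x : (x \in eigenspace E a) = (E x == a *: x).
Proof. by rewrite memv_ker !lfunE /= opp_lfunE !lfunE /= lfunE subr_eq0. Qed.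

Lemma half_sum (two_neq0 : 2%:R != 0 :> K) (x y : V) :
  x = 2%:R^-1 *: (x + y) + 2%:R^-1 *: (x - y).
Proof. by rewrite -scalerDr addrACA subrr addr0 -mulr2n -scaler_nat scalerK. Qed.

Lemma eq_opp_eq0 (two_neq0 : 2%:R != 0 :> K) (x : V) : x = - x -> x = 0.
Proof.
by move=> xN; rewrite (half_sum two_neq0 x x) subrr {2}xN subrr !scaler0 addr0.
Qed.

Lemma involution_eigenspaces E : 2%:R != 0 :> K ->
    (E \o E)%VF = \1%VF ->
  (eigenspace E 1 + eigenspace E (-1))%VS = fullv
  /\ directv (eigenspace E 1 + eigenspace E (-1)).
Proof.
move=> two_neq0 /lfunP EE.
have EK x : E (E x) = x by have := EE x; rewrite !lfunE.
split.
  apply/eqP; rewrite eqEsubv subvf; apply/subvP => x _.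
  (* E swaps x and E x, so it fixes their sum and negates their difference. *)
  rewrite (half_sum two_neq0 x (E x)).
  apply: memv_add; rewrite mem_eigenspace (linearZ_LR E).
    by rewrite (linearD E) /= EK scale1r addrC.
  by rewrite (linearB E) /= EK scaleN1r -scalerN opprB.
apply/directv_addP/eqP; rewrite -subv0; apply/subvP => x.
rewrite memv_cap !mem_eigenspace scale1r scaleN1r memv0 => /andP[/eqP-> /eqP xN].
by rewrite (eq_opp_eq0 two_neq0 xN).
Qed.

(** When [U] and [W] are complementary, this is the involution with eigenspaces
    [U] for 1 and [W] for -1. *)
Definition reflection U W : 'End(V) := (daddv_pi U W - daddv_pi W U)%VF.

Section Reflection.
Variables U W : {vspace V}.
Hypotheses (UW_full : (U + W = fullv)%VS) (UW_direct : directv (U + W)).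

Let UW0 : (U :&: W = 0)%VS. Proof. exact/directv_addP. Qed.
Let WU0 : (W :&: U = 0)%VS. Proof. by rewrite capvC. Qed.

Lemma reflectionE x : reflection U W x = daddv_pi U W x - daddv_pi W U x.
Proof. by rewrite lfunE /= opp_lfunE. Qed.

Lemma reflection_decomposition x : x = daddv_pi U W x + daddv_pi W U x.
Proof. by rewrite daddv_pi_add // UW_full memvf. Qed.

Lemma reflection_l x : x \in U -> reflection U W x = x.
Proof.
move=> xU; have := reflection_decomposition x; rewrite reflectionE daddv_pi_id //.
by rewrite -{1}[x]addr0 => /addrI <-; rewrite subr0.
Qed.

Lemma reflection_r x : x \in W -> reflection U W x = - x.
Proof.
move=> xW; have := reflection_decomposition x.
rewrite reflectionE (daddv_pi_id WU0) //.
by rewrite -{1}[x]add0r => /addIr <-; rewrite sub0r.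
Qed.

Lemma reflection_involutive : (reflection U W \o reflection U W)%VF = \1%VF.
Proof.
apply/lfunP => x; rewrite comp_lfunE id_lfunE (reflectionE x) linearB /=.
rewrite reflection_l ?memv_pi // reflection_r ?memv_pi // opprK.
by rewrite -reflection_decomposition.
Qed.

Hypothesis two_neq0 : 2%:R != 0 :> K.

Lemma eigenspace_reflection_l : eigenspace (reflection U W) 1 = U.
Proof.
apply/vspaceP => x; rewrite mem_eigenspace scale1r.
apply/eqP/idP => [fx|]; last exact: reflection_l.
have x_dec := reflection_decomposition x.
move: fx; rewrite reflectionE [RHS]x_dec => /addrI/esym/(eq_opp_eq0 two_neq0) xW0.
by rewrite x_dec xW0 addr0 memv_pi.
Qed.

Lemma eigenspace_reflection_r : eigenspace (reflection U W) (-1) = W.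
Proof.
apply/vspaceP => x; rewrite mem_eigenspace scaleN1r.
apply/eqP/idP => [fx|]; last exact: reflection_r.
have x_dec := reflection_decomposition x.
move: fx; rewrite reflectionE [X in _ = - X]x_dec opprD => /addIr.
by move=> /(eq_opp_eq0 two_neq0) xU0; rewrite x_dec xU0 add0r memv_pi.
Qed.

End Reflection.
End Involutions.

(** * Integrability and subalgebras *)

Section Integrability.
Variables (K : fieldType) (g : vectType K) (br : g -> g -> g -> g).
Hypothesis br_three_lie : three_lie_bracket br.
Hypothesis two_neq0 : 2%:R != 0 :> K.
Variable E : 'End(g).

Local Notation eigenspace := passmx.leigenspace.

Lemma bracketD1 x1 x2 y z : br (x1 + x2) y z = br x1 y z + br x2 y z.
Proof.
by have := three_lie_linear1 br_three_lie y z 1 x1 x2; rewrite !scale1r.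
Qed.

Lemma bracketD2 x y1 y2 z : br x (y1 + y2) z = br x y1 z + br x y2 z.
Proof.
by have := three_lie_linear2 br_three_lie x z 1 y1 y2; rewrite !scale1r.
Qed.

Lemma bracketD3 x y z1 z2 : br x y (z1 + z2) = br x y z1 + br x y z2.
Proof.
by have := three_lie_linear3 br_three_lie x y 1 z1 z2; rewrite !scale1r.
Qed.

Lemma bracketZ1 a x y z : br (a *: x) y z = a *: br x y z.
Proof. exact: (GRing.scalable_linear (three_lie_linear1 br_three_lie y z)). Qed.

Lemma bracketZ2 a x y z : br x (a *: y) z = a *: br x y z.
Proof. exact: (GRing.scalable_linear (three_lie_linear2 br_three_lie x z)). Qed.

Lemma bracketZ3 a x y z : br x y (a *: z) = a *: br x y z.
Proof. exact: (GRing.scalable_linear (three_lie_linear3 br_three_lie x y)). Qed.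

Definition integrability_rhs x y z :=
  br (E x) (E y) (E z) + br (E x) y z + br x (E y) z + br x y (E z)
    - E (br (E x) (E y) z) - E (br x (E y) (E z)) - E (br (E x) y (E z)).

Lemma integrability_rhsD1 x1 x2 y z :
  integrability_rhs (x1 + x2) y z
  = integrability_rhs x1 y z + integrability_rhs x2 y z.
Proof.
rewrite /integrability_rhs !(bracketD1, linearD E) /= !opprD.
by do 6?[rewrite [RHS]addrACA; congr (_ + _)].
Qed.

Lemma integrability_rhsD2 x y1 y2 z :
  integrability_rhs x (y1 + y2) z
  = integrability_rhs x y1 z + integrability_rhs x y2 z.
Proof.
rewrite /integrability_rhs !(bracketD2, linearD E) /= !opprD.
by do 6?[rewrite [RHS]addrACA; congr (_ + _)].
Qed.

Lemma integrability_rhsD3 x y z1 z2 :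
  integrability_rhs x y (z1 + z2)
  = integrability_rhs x y z1 + integrability_rhs x y z2.
Proof.
rewrite /integrability_rhs !(bracketD3, linearD E) /= !opprD.
by do 6?[rewrite [RHS]addrACA; congr (_ + _)].
Qed.

(** The eigenvalues come out of the brackets, leaving only B = [br x y z] and
    its image; the two scalars decide what integrability means on each triple of
    eigenspaces. *)
Lemma integrability_rhs_eigen a b c x y z :
    x \in eigenspace E a -> y \in eigenspace E b -> z \in eigenspace E c ->
  integrability_rhs x y z =
    (a * b * c + a + b + c) *: br x y z
      - (a * b + b * c + a * c) *: E (br x y z).
Proof.
rewrite !mem_eigenspace => /eqP xE /eqP yE /eqP zE.
rewrite /integrability_rhs xE yE zE !(bracketZ1, bracketZ2, bracketZ3).
have EZ k v : E (k *: v) = k *: E v by rewrite linearZ_LR.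
by rewrite !EZ !scalerA !scalerDl !opprD !addrA.
Qed.

(** With a = b = c and a^2 = 1 the integrability condition on B = [br x y z]
    reads E B = 4 a B - 3 E B, so dividing by 4 gives E B = a B. *)
Lemma eigenspace_subalgebra a : a ^+ 2 = 1 ->
    (forall x y z, E (br x y z) = integrability_rhs x y z) ->
  three_lie_subalgebra br (eigenspace E a).
Proof.
move=> a2 integrable x y z xE yE zE; rewrite mem_eigenspace -subr_eq0.
have /eqP := integrable x y z; rewrite (integrability_rhs_eigen xE yE zE).
rewrite -!expr2 a2 mul1r -subr_eq0 opprB addrA -{1}[E _]scale1r -scalerDl.
have -> : 1 + (1 + 1 + 1) = 2%:R * 2%:R :> K by ring.
have -> : a + a + a + a = 2%:R * 2%:R * a by ring.
by rewrite -[(_ * a) *: _]scalerA -scalerBr scaler_eq0 mulf_eq0 (negPf two_neq0).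
Qed.

(** Equal signs need the subalgebra hypothesis; for two signs against one the
    condition holds identically. *)
Lemma integrable_on_eigenvectors (s t u : bool) x y z :
    (forall r : bool, three_lie_subalgebra br (eigenspace E ((-1) ^+ r))) ->
    x \in eigenspace E ((-1) ^+ s) -> y \in eigenspace E ((-1) ^+ t) ->
    z \in eigenspace E ((-1) ^+ u) ->
  E (br x y z) = integrability_rhs x y z.
Proof.
move=> sub xE yE zE; rewrite (integrability_rhs_eigen xE yE zE).
have [/andP[/eqP st /eqP su]|] := boolP ((t == s) && (u == s)).
  subst t u; have := sub s x y z xE yE zE; rewrite mem_eigenspace => /eqP ->.
  rewrite scalerA -scalerBl; congr (_ *: _).
  by case: s {xE yE zE}; rewrite /=; ring.
move=> stu; set c1 := (X in X *: br x y z - _); set c2 := (X in _ - X *: _).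
have -> : c1 = 0.
  by rewrite /c1; case: s t u stu {xE yE zE c1 c2} => [] [] [] //= _; ring.
have -> : c2 = -1.
  by rewrite /c2; case: s t u stu {xE yE zE c1 c2} => [] [] [] //= _; ring.
by rewrite scale0r scaleN1r sub0r opprK.
Qed.

(** Both sides of the integrability condition are additive in each argument, so
    it suffices to check it on eigenvectors. *)
Lemma integrable_of_subalgebras :
    (eigenspace E 1 + eigenspace E (-1))%VS = fullv ->
    three_lie_subalgebra br (eigenspace E 1) ->
    three_lie_subalgebra br (eigenspace E (-1)) ->
  forall x y z, E (br x y z) = integrability_rhs x y z.
Proof.
move=> full subp subm x y z.
have sub (r : bool) : three_lie_subalgebra br (eigenspace E ((-1) ^+ r)).
  by case: r.
have split_vec v : exists2 v1, v1 \in eigenspace E ((-1) ^+ false)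
    & exists2 v2, v2 \in eigenspace E ((-1) ^+ true) & v = v1 + v2.
  by apply/memv_addP; rewrite full memvf.
have [x1 x1E [x2 x2E ->]] := split_vec x.
have [y1 y1E [y2 y2E ->]] := split_vec y.
have [z1 z1E [z2 z2E ->]] := split_vec z.
rewrite !(bracketD1, bracketD2, bracketD3) !(linearD E) /=.
rewrite !(integrability_rhsD1, integrability_rhsD2, integrability_rhsD3).
have pure s t u a b c := @integrable_on_eigenvectors s t u a b c sub.
rewrite (pure _ _ _ _ _ _ x1E y1E z1E) (pure _ _ _ _ _ _ x1E y1E z2E).
rewrite (pure _ _ _ _ _ _ x1E y2E z1E) (pure _ _ _ _ _ _ x1E y2E z2E).
rewrite (pure _ _ _ _ _ _ x2E y1E z1E) (pure _ _ _ _ _ _ x2E y1E z2E).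
by rewrite (pure _ _ _ _ _ _ x2E y2E z1E) (pure _ _ _ _ _ _ x2E y2E z2E).
Qed.

End Integrability.

(** * Compatibility with the symplectic form *)

Lemma real_or_complex_two_neq0 (R : realType) (K : fieldType) :
  real_or_complex_field R K -> 2%:R != 0 :> K.
Proof. by case; rewrite Num.Theory.pnatr_eq0. Qed.

Section ParaKahler.
Variables (K : fieldType) (g : vectType K).
Variable omega : {skew_symmetric g}.
Hypothesis two_neq0 : 2%:R != 0 :> K.

(** Compatibility gives omega x y = a^2 omega x y = - omega x y on the
    eigenspace. *)
Lemma isotropic_eigenspace (E : 'End(g)) a : a ^+ 2 = 1 ->
    (forall x y, omega (E x) (E y) = - omega x y) ->
  isotropic omega (passmx.leigenspace E a).
Proof.
move=> a2 compat x y; rewrite !mem_eigenspace => /eqP xE /eqP yE.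
have /eqP := compat x y; rewrite xE yE linearZl_LR linearZr_LR /= mulrA -expr2 a2.
by rewrite mul1r -addr_eq0 -mulr2n -mulr_natl mulf_eq0 (negPf two_neq0) => /eqP.
Qed.

Lemma reflection_anti_isometry gp gm :
    isotropic omega gp -> isotropic omega gm ->
    (gp + gm)%VS = fullv -> directv (gp + gm) ->
  forall x y, omega (reflection gp gm x) (reflection gp gm y) = - omega x y.
Proof.
move=> isop isom full dir x y.
rewrite {2}(reflection_decomposition full dir x).
rewrite {2}(reflection_decomposition full dir y) !reflectionE.
have := memv_pi gp gm x; have := memv_pi gp gm y.
have := memv_pi gm gp x; have := memv_pi gm gp y.
move: (daddv_pi gp gm x) (daddv_pi gp gm y) => xp yp.
move: (daddv_pi gm gp x) (daddv_pi gm gp y) => xm ym ymE xmE ypE xpE.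
rewrite !(linearBl, linearBr, linearDl, linearDr) /=.
rewrite (isop xp yp) // (isom xm ym) //; ring.
Qed.

End ParaKahler.

Theorem theorem8p3 (R : realType) (K : fieldType)
    (K_real_or_complex : real_or_complex_field R K)
    (g : vectType K) (g_nonzero : (0 < \dim {:g})%N)
    (br : g -> g -> g -> g) (omega : {skew_symmetric g})
    (br_three_lie : three_lie_bracket br)
    (omega_symplectic : symplectic_structure br omega) :
  (exists2 E : 'End(g), paracomplex_structure br E & para_kahler br omega E)
  <->
  (exists gp gm : {vspace g},
    [/\ isotropic omega gp /\ three_lie_subalgebra br gp,
        isotropic omega gm /\ three_lie_subalgebra br gm,
        (gp + gm)%VS = fullv
      & directv (gp + gm)%VS]).
Proof.
have two_neq0 := real_or_complex_two_neq0 K_real_or_complex.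
have nondeg := symplectic_nondegenerate omega_symplectic.
split=> [[E [[EE _ _ integrable] _] [_ _ _ compat]]|[gp [gm]]].
  have minus1_sqr : (-1) ^+ 2 = 1 :> K by rewrite sqrrN expr1n.
  have [full dir] := involution_eigenspaces two_neq0 EE.
  exists (passmx.leigenspace E 1), (passmx.leigenspace E (-1)).
  have iso := isotropic_eigenspace two_neq0 _ compat.
  have sub a a2 := eigenspace_subalgebra br_three_lie two_neq0 a2 integrable (a := a).
  by split=> //; split; do ?[exact: iso (expr1n _ _) | exact: iso minus1_sqr
                           | exact: sub (expr1n _ _) | exact: sub minus1_sqr].
move=> [[isop subp] [isom subm] full dir].
pose E := reflection gp gm.
have Ep : passmx.leigenspace E 1 = gp by exact: eigenspace_reflection_l.
have Em : passmx.leigenspace E (-1) = gm by exact: eigenspace_reflection_r.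
have dims := dim_isotropic_summands nondeg isop isom full.
have dimp : (0 < \dim gp)%N.
  move: g_nonzero; rewrite -full dimv_disjoint_sum; last exact/directv_addP.
  by rewrite -dims addnn double_gt0.
have paraE : paracomplex_structure br E.
  split; last by rewrite Ep Em.
  split.
  - exact: reflection_involutive.
  (* E = 1 would fix the nonzero vector [vpick gm], which E negates. *)
  - move=> E1; have := reflection_r full dir (memv_pick gm).
    rewrite -/E E1 id_lfunE => /(eq_opp_eq0 two_neq0)/eqP.
    by rewrite vpick0 -dimv_eq0 -dims eqn0Ngt dimp.
  - move=> EN1; have := reflection_l full dir (memv_pick gp).
    rewrite -/E EN1 opp_lfunE id_lfunE => /esym/(eq_opp_eq0 two_neq0)/eqP.
    by rewrite vpick0 -dimv_eq0 eqn0Ngt dimp.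
  - by apply: integrable_of_subalgebras => //; rewrite ?Ep ?Em.
exists E => //; split=> //; exact: reflection_anti_isometry.
Qed.
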